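(* Let $f:\mathbb{R}^m\times\mathbb{R}^n\to\mathbb{R}$ and let $\mathcal{S}(x):=\arg\min_{y\in\mathbb{R}^n}f(x,y)$ for $x\in\mathbb{R}^m$. Assume that: (A1) $f$ is $L_f$-smooth and twice differentiable, and $\nabla\nabla_y f$ is $H_f$-Lipschitz continuous, i.e., for all $x_1,x_2\in\mathbb{R}^m$ and $y_1,y_2\in\mathbb{R}^n$, $$\|\nabla\nabla_y f(x_1,y_1)-\nabla\nabla_y f(x_2,y_2)\|\le H_f\left(\|x_1-x_2\|+\|y_1-y_2\|\right);$$ (A2) $\mathcal{S}(x)$ is nonempty, closed and convex for all $x\in\mathbb{R}^m$; (A3) there exists a scalar $\tau>0$ such that $\mathrm{dist}(y,\mathcal{S}(x))\le\tau\|\nabla_y f(x,y)\|$ for all $x\in\mathbb{R}^m$ and $y\in\mathbb{R}^n$. Then the set-valued function $\mathcal{S}:x\mapsto\arg\min_{y\in\mathbb{R}^n}f(x,y)$ is $L_{\mathcal{S}}$-smooth (in the sense of set smoothness) with $$L_{\mathcal{S}}=\max\left\{2H_f\tau(1+9L_f^2\tau^2),\;4L_f^2\tau^2\right\}.$$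
   Context: Vector norms are Euclidean and matrix norms are $\ell_2$ operator norms. $\nabla$ is the gradient with respect to the joint variable $(x,y)$, $\nabla_y$ the gradient with respect to $y$, and $\nabla\nabla_y f$ is the derivative of $\nabla_y f$ with respect to $(x,y)$ (an $n\times(m+n)$ matrix). $f$ is $L_f$-smooth if it is differentiable with $L_f$-Lipschitz gradient. $\mathrm{dist}(y,S)=\min_{z\in S}\|y-z\|$. Set smoothness: a set-valued function $\mathcal{Y}:\mathbb{R}^m\rightrightarrows\mathbb{R}^n$ with convex domain $\mathrm{dom}(\mathcal{Y})$ is $L$-smooth if for any $x_1,x_2\in\mathrm{dom}(\mathcal{Y})$, any $\theta\in[0,1]$, and all $y\in\mathcal{Y}(\theta x_1+(1-\theta)x_2)$, there exist $y_1\in\mathcal{Y}(x_1)$ and $y_2\in\mathcal{Y}(x_2)$ such that $$\|\theta y_1+(1-\theta)y_2-y\|\le\frac{L}{2}\theta(1-\theta)\|x_1-x_2\|^2\quad\text{and}\quad\|y_1-y_2\|^2\le L\|x_1-x_2\|^2.$$ *)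

(* Defs.v *)
From mathcomp Require Export all_boot all_order all_algebra.
From mathcomp Require Export all_classical all_reals all_analysis.

Set Implicit Arguments.
Unset Strict Implicit.
Unset Printing Implicit Defensive.
Import Order.TTheory GRing.Theory Num.Theory.
Import numFieldNormedType.Exports.

Local Open Scope classical_set_scope.
Local Open Scope ring_scope.

(* Vectors are rows. The library norm on ['rV[R]_k] is the sup norm, whence the
   norm below; both induce the same topology and the same differential, so
   [closed], [differentiable] and ['J] are taken from the library. *)
Definition norm2 (R : realType) (k : nat) (v : 'rV[R]_k) : R :=
  Num.sqrt (\sum_(i < k) v 0 i ^+ 2).

(* Linear maps act on the right of rows: [A] stands for [h |-> h *m A], i.e.,
   for the transpose of the matrix acting on columns. The unit ball is used
   instead of the sphere so that the set is nonempty also when p = 0. *)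
Definition opnorm2 (R : realType) (p q : nat) (A : 'M[R]_(p, q)) : R :=
  sup [set norm2 (h *m A) | h in [set h : 'rV[R]_p | norm2 h <= 1]].

(* For a nonempty closed [S] the infimum is a minimum. *)
Definition dist (R : realType) (k : nat) (y : 'rV[R]_k) (S : set 'rV[R]_k) : R :=
  inf [set norm2 (y - z) | z in S].

Definition gradient (R : realType) (k : nat) (g : 'rV[R]_k -> R)
    (z : 'rV[R]_k) : 'rV[R]_k :=
  \row_(i < k) 'D_(delta_mx 0 i) g z.

Definition L_smooth (R : realType) (k : nat) (L : R) (g : 'rV[R]_k -> R) : Prop :=
  (forall z, differentiable g z) /\
  (forall z1 z2,
     norm2 (gradient g z1 - gradient g z2) <= L * norm2 (z1 - z2)).

Definition twice_differentiable (R : realType) (k : nat) (g : 'rV[R]_k -> R)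
    : Prop :=
  (forall z, differentiable g z) /\ (forall z, differentiable (gradient g) z).

Definition joint (R : realType) (m n : nat) (f : 'rV[R]_m -> 'rV[R]_n -> R)
    (z : 'rV[R]_(m + n)) : R := f (lsubmx z) (rsubmx z).

Definition grad_y (R : realType) (m n : nat) (f : 'rV[R]_m -> 'rV[R]_n -> R)
    (x : 'rV[R]_m) (y : 'rV[R]_n) : 'rV[R]_n := gradient (f x) y.

(* The transpose of the n x (m+n) matrix of the derivative of [grad_y] with
   respect to (x, y), because of the row convention. *)
Definition grad_grad_y (R : realType) (m n : nat) (f : 'rV[R]_m -> 'rV[R]_n -> R)
    (x : 'rV[R]_m) (y : 'rV[R]_n) : 'M[R]_(m + n, n) :=
  'J (fun z : 'rV[R]_(m + n) => grad_y f (lsubmx z) (rsubmx z)) (row_mx x y).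

Definition argmin (R : realType) (m n : nat) (f : 'rV[R]_m -> 'rV[R]_n -> R)
    (x : 'rV[R]_m) : set 'rV[R]_n :=
  [set y | forall y', f x y <= f x y'].

Definition convex (R : realType) (k : nat) (A : set 'rV[R]_k) : Prop :=
  convex_set (A : set (convex_lmodType 'rV[R]_k)).

Definition dom (R : realType) (m n : nat) (Y : 'rV[R]_m -> set 'rV[R]_n)
    : set 'rV[R]_m := [set x | Y x !=set0].

Definition set_smooth (R : realType) (m n : nat) (L : R)
    (Y : 'rV[R]_m -> set 'rV[R]_n) : Prop :=
  convex (dom Y) /\
  forall x1 x2, dom Y x1 -> dom Y x2 ->
  forall theta : R, 0 <= theta <= 1 ->
  forall y, Y (theta *: x1 + (1 - theta) *: x2) y ->
  exists y1 y2, [/\ Y x1 y1, Y x2 y2,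
    norm2 (theta *: y1 + (1 - theta) *: y2 - y)
      <= L / 2 * theta * (1 - theta) * norm2 (x1 - x2) ^+ 2
    & norm2 (y1 - y2) ^+ 2 <= L * norm2 (x1 - x2) ^+ 2].

(* Main.v *)
Require Import Defs.
From mathcomp Require Import lra ring.
Import Order.TTheory GRing.Theory Num.Theory.
Import numFieldNormedType.Exports.
Local Open Scope classical_set_scope.
Local Open Scope ring_scope.

(* Let [x = theta x1 + (1 - theta) x2], [d = x1 - x2] and [a = tau Lf]. Since
   [grad_y f] vanishes on the graph of [S = argmin f], the error bound makes [S]
   [a]-Lipschitz, which yields [y1] in [S x1] near [y]. Extrapolating the segment
   from [(x1, y1)] to [(x, y)] up to [x2] gives a point [y2'] such that
   [y = theta y1 + (1 - theta) y2']; as [grad_y f] vanishes at two points of that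
   line, its value at [(x2, y2')] is a second difference, of order
   [theta Hf |d|^2], and the projection [y2] of [y2'] on [S x2] is at distance at
   most [E = O(theta |d|^2)] of [y2']. If [E <= a |d|], then [|y1 - y2| <= 2 a |d|].
   Otherwise [|d|] is so large that the first-order error made by projecting [y]
   itself on both [S x1] and [S x2] is below the quadratic bound; this last step
   uses [theta <= 1 / 2], which holds up to exchanging [x1] and [x2]. *)

(** * Euclidean norm, operator norm and distance to a closed set *)

Section EuclideanNorm.
Context {R : realType}.

Definition dotr {k : nat} (u v : 'rV[R]_k) : R := \sum_(i < k) u 0 i * v 0 i.

Lemma dotr_norm2 {k} (u : 'rV[R]_k) : dotr u u = norm2 u ^+ 2.
Proof.
rewrite sqr_sqrtr; first by apply: eq_bigr => i _; rewrite expr2.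
by apply: sumr_ge0 => i _; rewrite sqr_ge0.
Qed.

Lemma dotrC {k} (u v : 'rV[R]_k) : dotr u v = dotr v u.
Proof. by apply: eq_bigr => i _; rewrite mulrC. Qed.

Lemma dotrDl {k} (u v w : 'rV[R]_k) : dotr (u + v) w = dotr u w + dotr v w.
Proof. by rewrite -big_split; apply: eq_bigr => i _; rewrite mxE mulrDl. Qed.

Lemma dotrZl {k} a (u w : 'rV[R]_k) : dotr (a *: u) w = a * dotr u w.
Proof. by rewrite mulr_sumr; apply: eq_bigr => i _; rewrite mxE mulrA. Qed.

Lemma dotrBl {k} (u v w : 'rV[R]_k) : dotr (u - v) w = dotr u w - dotr v w.
Proof. by rewrite -scaleN1r dotrDl dotrZl mulN1r. Qed.

Lemma norm2_ge0 {k} (u : 'rV[R]_k) : 0 <= norm2 u.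
Proof. exact: sqrtr_ge0. Qed.
Hint Resolve norm2_ge0 : core.

Lemma norm2_eq0 {k} (u : 'rV[R]_k) : norm2 u = 0 -> u = 0.
Proof.
move=> u0; apply/rowP => i; rewrite mxE; apply/eqP; rewrite -sqrf_eq0.
have : \sum_(i < k) u 0 i ^+ 2 == 0.
  have : dotr u u == 0 by rewrite dotr_norm2 u0 expr0n.
  by congr (_ == _); apply: eq_bigr => j _; rewrite expr2.
rewrite psumr_eq0; last by move=> j _; rewrite sqr_ge0.
by move=> /allP/(_ i)/= ->//; rewrite mem_index_enum.
Qed.

Lemma norm2Z {k} a (u : 'rV[R]_k) : norm2 (a *: u) = `|a| * norm2 u.
Proof.
rewrite /norm2 -sqrtr_sqr -sqrtrM ?sqr_ge0// mulr_sumr; congr Num.sqrt.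
by apply: eq_bigr => i _; rewrite mxE exprMn.
Qed.

Lemma norm20 {k} : norm2 (0 : 'rV[R]_k) = 0.
Proof. by rewrite -(scale0r 0) norm2Z normr0 mul0r. Qed.

Lemma norm2N {k} (u : 'rV[R]_k) : norm2 (- u) = norm2 u.
Proof. by rewrite -scaleN1r norm2Z normrN1 mul1r. Qed.

Lemma norm2B {k} (u v : 'rV[R]_k) : norm2 (u - v) = norm2 (v - u).
Proof. by rewrite -norm2N opprB. Qed.

(** Cauchy-Schwarz: the square of the norm of [norm2 v *: u - norm2 u *: v] expands to
    [2 |u| |v| (|u| |v| - dotr u v)], and [|u| |v|] can be cancelled when both norms are nonzero. *)
Lemma dotr_le {k} (u v : 'rV[R]_k) : dotr u v <= norm2 u * norm2 v.
Proof.
have [u0|u0] := eqVneq (norm2 u) 0.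
  by rewrite u0 mul0r (norm2_eq0 _ u0) -(scale0r 0) dotrZl mul0r.
have [v0|v0] := eqVneq (norm2 v) 0.
  by rewrite v0 mulr0 (norm2_eq0 _ v0) dotrC -(scale0r 0) dotrZl mul0r.
have up : 0 < norm2 u by rewrite lt_neqAle eq_sym u0 norm2_ge0.
have vp : 0 < norm2 v by rewrite lt_neqAle eq_sym v0 norm2_ge0.
have := sqr_ge0 (norm2 (norm2 v *: u - norm2 u *: v)).
rewrite -dotr_norm2 dotrBl !dotrZl ![dotr _ (_ - _)]dotrC !dotrBl !dotrZl.
rewrite [dotr v u]dotrC !dotr_norm2 => h.
have : 0 <= 2 * (norm2 u * norm2 v) * (norm2 u * norm2 v - dotr u v) by lra.
by rewrite pmulr_rge0 ?subr_ge0// !mulr_gt0.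
Qed.

Lemma ler_norm2D {k} (u v : 'rV[R]_k) : norm2 (u + v) <= norm2 u + norm2 v.
Proof.
rewrite -ler_sqr ?nnegrE ?addr_ge0//.
rewrite -dotr_norm2 dotrDl ![dotr _ (_ + _)]dotrC !dotrDl !dotr_norm2.
by rewrite [dotr v u]dotrC; have := dotr_le u v; lra.
Qed.

Lemma norm2_delta {k} (i : 'I_k) : norm2 (delta_mx 0 i : 'rV[R]_k) = 1.
Proof.
rewrite /norm2 (bigD1 i)//= mxE !eqxx expr1n big1 ?addr0 ?sqrtr1// => j ji.
by rewrite mxE (negbTE ji) andbF expr0n.
Qed.

Lemma norm2_le_sum {k} (u : 'rV[R]_k) : norm2 u <= \sum_(i < k) `|u 0 i|.
Proof.
rewrite {1}(row_sum_delta u).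
elim/big_ind2 : _ => [|a b c d ab cd|i _]; first by rewrite norm20.
  by rewrite (le_trans (ler_norm2D _ _))// lerD.
by rewrite norm2Z norm2_delta mulr1.
Qed.

Lemma ler_coord_norm2 {k} (u : 'rV[R]_k) i : `|u 0 i| <= norm2 u.
Proof.
rewrite -sqrtr_sqr ler_wsqrtr// (bigD1 i)//= lerDl sumr_ge0// => j _.
by rewrite sqr_ge0.
Qed.

Lemma norm2_row_mx_sqr {m n} (u : 'rV[R]_m) (v : 'rV[R]_n) :
  norm2 (row_mx u v) ^+ 2 = norm2 u ^+ 2 + norm2 v ^+ 2.
Proof.
rewrite -!dotr_norm2 /dotr big_split_ord /=.
by congr (_ + _); apply: eq_bigr => i _; rewrite ?row_mxEl ?row_mxEr.
Qed.

Lemma norm2_row_mxr0 {m n} (u : 'rV[R]_m) : norm2 (row_mx u (0 : 'rV[R]_n)) = norm2 u.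
Proof.
apply/eqP; rewrite -(@eqrXn2 _ 2)//.
by rewrite norm2_row_mx_sqr norm20 expr0n addr0.
Qed.

Lemma norm2_row_mx_le {m n} (u : 'rV[R]_m) (v : 'rV[R]_n) :
  norm2 (row_mx u v) <= norm2 u + norm2 v.
Proof.
rewrite -ler_sqr ?nnegrE ?addr_ge0//= norm2_row_mx_sqr sqrrD lerD2r lerDl.
by rewrite mulrn_wge0 ?mulr_ge0.
Qed.

Lemma norm2_rsubmx_le {m n} (u : 'rV[R]_(m + n)) : norm2 (rsubmx u) <= norm2 u.
Proof.
by rewrite -ler_sqr ?nnegrE// -{2}(hsubmxK u) norm2_row_mx_sqr lerDr sqr_ge0.
Qed.

(** The sum of the absolute entries of [A] is an upper bound. This makes [opnorm2] a true supremum
    rather than the default value of [sup]. *)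
Lemma opnorm2_has_sup {p q} (A : 'M[R]_(p, q)) :
  has_sup [set norm2 (h *m A) | h in [set h : 'rV[R]_p | norm2 h <= 1]].
Proof.
split; first by exists (norm2 (0 *m A)), 0; rewrite //= norm20.
exists (\sum_(j < q) \sum_(i < p) `|A i j|) => _ [h /= h1 <-].
rewrite (le_trans (norm2_le_sum _))// ler_sum// => j _; rewrite mxE.
rewrite (le_trans (ler_norm_sum _ _ _))// ler_sum// => i _.
by rewrite normrM ler_piMl// (le_trans (ler_coord_norm2 _ _)).
Qed.

Lemma opnorm2_ge0 {p q} (A : 'M[R]_(p, q)) : 0 <= opnorm2 A.
Proof.
apply: (le_trans (norm2_ge0 (0 *m A))).
by apply: (sup_upper_bound (opnorm2_has_sup A)); exists 0; rewrite //= norm20.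
Qed.

Lemma norm2_mulmx_le {p q} (h : 'rV[R]_p) (A : 'M[R]_(p, q)) :
  norm2 (h *m A) <= opnorm2 A * norm2 h.
Proof.
have [h0|h0] := eqVneq (norm2 h) 0.
  by rewrite h0 mulr0 (norm2_eq0 _ h0) mul0mx norm20.
have hp : 0 < norm2 h by rewrite lt_neqAle eq_sym h0 norm2_ge0.
rewrite -ler_pdivrMr//.
have hVp : 0 <= (norm2 h)^-1 by rewrite invr_ge0.
apply: (sup_upper_bound (opnorm2_has_sup A)).
exists ((norm2 h)^-1 *: h); first by rewrite /= norm2Z ger0_norm// mulVf.
by rewrite -scalemxAl norm2Z ger0_norm// mulrC.
Qed.

Lemma norm2_continuous {k} : continuous (@norm2 R k).
Proof.
have sq : continuous (fun v : 'rV[R]_k => \sum_(i < k) v 0 i ^+ 2 : R).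
  apply: continuous_big => [|i _ v]; first exact: add_continuous.
  by apply: (@continuous_comp _ _ _ (fun v : 'rV[R]_k => v 0 i : R) (fun x : R => x ^+ 2));
    [exact: coord_continuous|exact: exprn_continuous].
by move=> u; apply: continuous_comp; [exact: sq|exact: sqrt_continuous].
Qed.

(** Only the part [K] of [S] within distance [r] of [y] matters, [r] being the distance to some [z0]
    in [S]. It is compact, so the continuous distance to [y] has a minimum there. *)
Lemma dist_attained {k} (y : 'rV[R]_k) (S : set 'rV[R]_k) :
  S !=set0 -> closed S -> exists2 z, S z & norm2 (y - z) <= dist y S.
Proof.
move=> [z0 Sz0] Scl; pose r := norm2 (y - z0).
have cont : continuous (fun z : 'rV[R]_k => norm2 (y - z)).
  move=> z; apply: continuous_comp; last exact: norm2_continuous.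
  by apply: continuousB; [exact: cst_continuous|exact: cvg_id].
pose K := S `&` [set z | norm2 (y - z) <= r].
have Kcl : closed K.
  apply: closedI => //.
  have := @preimage_closed _ _ (fun z : 'rV[R]_k => norm2 (y - z)) [set x | x <= r].
  by apply; [move=> z _; exact: cont|exact: closed_le].
have Kbd : bounded_set K.
  exists (norm2 y + r); split; first exact: num_real.
  move=> M rM z [_ /= zr].
  have zM : norm2 z <= M.
    rewrite -(subKr y z) (le_trans (ler_norm2D _ _))// norm2N.
    by rewrite (le_trans _ (ltW rM))// lerD2l.
  (* Boundedness refers to the sup norm, which the Euclidean norm dominates. *)
  rewrite /Num.Def.normr/= mx_normrE; apply: bigmax_le => [|[i j] _/=].
    exact: le_trans zM.
  by rewrite ord1 (le_trans (ler_coord_norm2 _ _)).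
have K0 : K !=set0 by exists z0; split=> /=.
have [z /[!inE] -[Sz zr] zmin] := EVT_min_rV K0 (bounded_closed_compact Kbd Kcl)
  (continuous_subspaceT cont).
exists z => //; apply: lb_le_inf; first by exists r, z0.
move=> _ [z' Sz' <-]; have [z'r|/ltW rz'] := leP (norm2 (y - z')) r.
  by apply: zmin; rewrite inE.
exact: le_trans rz'.
Qed.

End EuclideanNorm.

(** * Second-difference estimates along a line *)

Section SecondDifference.
Context {R : realType}.

Lemma is_derive_line {V W : normedModType R} (g : V -> W) (z w : V) (t : R) :
  differentiable g (z + t *: w) ->
  is_derive t 1 (fun s : R => g (z + s *: w)) ('D_w g (z + t *: w)).
Proof.
move=> dg.
have dl : is_diff t (fun s : R => z + s *: w) (0 + *:%R ^~ w).
  exact: (is_diffD (f := cst z)).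
have dgl : differentiable (g \o (fun s : R => z + s *: w)) t.
  exact: differentiable_comp.
apply: DeriveDef; first exact: diff_derivable.
rewrite (deriveE _ dgl) diff_comp//= diff_val deriveE//.
by rewrite fctE/= add0r scale1r.
Qed.

(* Rolle twice on [phi x - k (x - b) (x - c)], with [k] chosen so that this
   function vanishes at [a] as well as at [b] and [c]. *)
Lemma second_difference_le (phi dphi : R -> R) (K a b c : R) :
  a < b -> b < c ->
  (forall t : R, is_derive t 1 phi (dphi t)) ->
  (forall s t, `|dphi s - dphi t| <= K * `|s - t|) ->
  phi b = 0 -> phi c = 0 ->
  `|phi a| <= K / 2 * ((b - a) * (c - a)).
Proof.
move=> ab bc dphiP dphiK phib phic.
have D0 : 0 < (b - a) * (c - a) by rewrite mulr_gt0// subr_gt0// (lt_trans ab).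
pose k := phi a / ((b - a) * (c - a)).
have phiaE : phi a = k * ((b - a) * (c - a)) by rewrite divfK// gt_eqF.
pose q : R -> R := (id - cst b) * (id - cst c).
pose psi := phi - k *: q.
have psiP (t : R) : is_derive t 1 psi (dphi t - k * (2 * t - b - c)).
  apply: is_derive_eq; congr (_ - _); rewrite /GRing.scale/=; congr (_ * _).
  by rewrite !fctE /GRing.scale/= /cst; ring.
have rolle x y : x < y -> psi x = psi y -> exists2 z, x < z < y & dphi z = k * (2 * z - b - c).
  move=> xy pxy; have [|| // |z /[!in_itv]/= zxy dz] := @Rolle R psi x y xy.
  - by move=> z _; apply: ex_derive.
  - apply: continuous_subspaceT => z.
    by apply: differentiable_continuous; apply/derivable1_diffP; apply: ex_derive.
  exists z => //; apply/eqP; rewrite -subr_eq0.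
  by have := @derive_val _ _ _ _ _ _ _ dz; rewrite (@derive_val _ _ _ _ _ _ _ (psiP z)) => ->.
have psiE x : psi x = phi x - k * ((x - b) * (x - c)) by [].
have [|s /andP[as_ sb] ds] := rolle a b ab.
  by rewrite !psiE phib phiaE; ring.
have [|t /andP[bt tc] dt] := rolle b c bc.
  by rewrite !psiE phib phic; ring.
have st : s < t by apply: lt_trans bt.
(* At the two Rolle points, [dphi t - dphi s = 2 k (t - s)], so the Lipschitz bound on [dphi] gives
   [|k| <= K / 2]. *)
have := dphiK t s; rewrite ds dt -mulrBr normrM.
have -> : 2 * t - b - c - (2 * s - b - c) = 2 * (t - s) by ring.
rewrite (normrM 2) normr_nat (gtr0_norm (x := t - s)) ?subr_gt0// mulrA.
rewrite ler_pM2r ?subr_gt0// -ler_pdivlMr// => kK.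
by rewrite phiaE normrM (gtr0_norm D0) ler_pM2r.
Qed.

(** Reduction to the scalar case: [g] along the line is paired with the fixed vector
    [v = g (z - theta *: w)], and the scalar estimate is applied at the nodes [- theta], [0] and
    [s]. *)
Lemma norm2_extrapolation {p q} (g : 'rV[R]_p -> 'rV[R]_q) (z w : 'rV[R]_p)
    (K s theta : R) :
  0 < s -> 0 <= theta -> 0 <= K ->
  (forall t, differentiable g (z + t *: w)) ->
  (forall t u, norm2 (w *m ('J g (z + t *: w) - 'J g (z + u *: w)))
     <= K * `|t - u|) ->
  g z = 0 -> g (z + s *: w) = 0 ->
  norm2 (g (z - theta *: w)) <= K / 2 * (theta * (s + theta)).
Proof.
(* The case [theta = 0] is apart, since the scalar estimate needs distinct nodes. *)
move=> s0; rewrite le_eqVlt => /predU1P[<-|th0] K0 dg JK gz gzs.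
  by rewrite scale0r subr0 gz norm20 mul0r mulr0.
set v := g _.
have [v0|v0] := eqVneq (norm2 v) 0.
  by rewrite v0 !mulr_ge0 ?addr_ge0 ?invr_ge0// ltW.
have vp : 0 < norm2 v by rewrite lt_neqAle eq_sym v0 norm2_ge0.
pose phi t := dotr (g (z + t *: w)) v.
pose dphi t := dotr (w *m 'J g (z + t *: w)) v.
have dphiP (t : R) : is_derive t 1 phi (dphi t).
  have dline := is_derive_line _ _ _ _ (dg t).
  (* A combination of coordinates with constant coefficients can be differentiated termwise. *)
  have -> : phi = \sum_(i < q) v 0 i *: (fun t => g (z + t *: w) 0 i).
    by apply/funext => x; rewrite fct_sumE; apply: eq_bigr => i _; rewrite mulrC.
  have -> : dphi t = \sum_(i < q) v 0 i *: ('D_w g (z + t *: w)) 0 i.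
    by apply: eq_bigr => i _; rewrite mulrC (deriveEjacobian _ (dg t)).
  apply: is_derive_sum => i; apply: is_deriveZ; apply: DeriveDef.
    by apply: (derivable_mxP _ _ _).1; apply: ex_derive.
  have /matrixP/(_ 0 i) := derive_mx (@ex_derive _ _ _ _ _ _ _ dline).
  by rewrite (@derive_val _ _ _ _ _ _ _ dline) mxE.
have dphiK t u : `|dphi t - dphi u| <= (K * norm2 v) * `|t - u|.
  rewrite -dotrBl -mulmxBr mulrAC ler_norml lerNl -mulN1r -dotrZl scaleN1r.
  by apply/andP; split; rewrite (le_trans (dotr_le _ _))// ler_wpM2r ?norm2_ge0//
    ?norm2N JK.
have := second_difference_le phi dphi _ (- theta) 0 s _ s0 dphiP dphiK.
rewrite /phi scale0r addr0 gz gzs scaleNr -/v dotr_norm2 oppr_lt0.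
have dot0 : dotr 0 v = 0 by rewrite -(scale0r 0) dotrZl mul0r.
(* The value of [phi] at [- theta] is [norm2 v ^+ 2] and the Lipschitz constant is [K * norm2 v];
   one factor [norm2 v] cancels. *)
move=> /(_ th0 dot0 dot0); rewrite ger0_norm ?sqr_ge0// opprK add0r.
have -> : K * norm2 v / 2 * (theta * (s + theta)) =
  K / 2 * (theta * (s + theta)) * norm2 v by ring.
by rewrite expr2 ler_pM2r.
Qed.

End SecondDifference.

(** * The partial gradient in [y] and first-order optimality *)

Section PartialGradient.
Context {R : realType} {m n : nat} (f : 'rV[R]_m -> 'rV[R]_n -> R).

(** The basis vector of index [rshift m i] is [(0, e_i)], so both partial derivatives are limits of
    the same quotient. Through this identity [grad_y f] inherits the regularity of the joint
    gradient. *)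
Lemma grad_yE x y : grad_y f x y = rsubmx (gradient (joint f) (row_mx x y)).
Proof.
apply/rowP => i; rewrite !mxE /derive.
have deltaE : (delta_mx 0 (rshift m i) : 'rV[R]_(m + n)) = row_mx 0 (delta_mx 0 i).
  apply/rowP => j; rewrite !mxE eqxx /=.
  by case: splitP => k; rewrite !mxE ?eqxx/= -val_eqE /= => ->;
    rewrite ?eqn_add2l// ltn_eqF// ltn_addr.
set F := (X in lim (X @ _) = _); set G := (X in _ = lim (X @ _)).
suff -> : F = G by [].
apply/funext => h; rewrite /F /G /joint /= deltaE.
by rewrite scale_row_mx add_row_mx !row_mxKl !row_mxKr scaler0 add0r.
Qed.

Lemma grad_y_argmin x y :
  (forall z, differentiable (joint f) z) -> argmin f x y -> grad_y f x y = 0.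
Proof.
move=> df ymin; apply/rowP => i; rewrite grad_yE !mxE.
set w := delta_mx _ _; set z := row_mx x y.
have dline (t : R) := is_derive_line (joint f) z w t (df _).
(* The line in direction [w] keeps [x] fixed, so [y] minimizes [f] along it. *)
have wl : lsubmx w = 0.
  apply/rowP => j; rewrite !mxE eqxx/= -val_eqE /=.
  by rewrite ltn_eqF// (leq_trans (ltn_ord j))// leq_addr.
(* The interval []-1, 1[] is an arbitrary one around 0, the minimum being global. *)
have dmin : is_derive (0 : R) 1 (fun s : R => joint f (z + s *: w)) 0.
  apply: (@derive1_at_min R _ (-1) 1) => [|t _||t _].
  - by rewrite (le_trans (lerN10 R)).
  - by apply: ex_derive.
  - by rewrite in_itv/= ltrN10 ltr01.
  - rewrite scale0r addr0 /joint !linearD !linearZ/= wl scaler0 addr0.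
    by rewrite row_mxKl row_mxKr; exact: ymin.
have := @derive_val _ _ _ _ _ _ _ (dline 0).
by rewrite scale0r addr0 => <-; exact: derive_val.
Qed.

Lemma differentiable_grad_y (z : 'rV[R]_(m + n)) :
  differentiable (gradient (joint f)) z ->
  differentiable (fun z => grad_y f (lsubmx z) (rsubmx z)) z.
Proof.
move=> dg; have -> : (fun z => grad_y f (lsubmx z) (rsubmx z)) =
    rsubmx \o gradient (joint f).
  by apply/funext => u; rewrite grad_yE hsubmxK.
by apply: differentiable_comp => //; exact: differentiable_rsubmx.
Qed.

Lemma grad_y_lipschitz L x1 x2 y1 y2 : L_smooth L (joint f) ->
  norm2 (grad_y f x1 y1 - grad_y f x2 y2) <= L * norm2 (row_mx (x1 - x2) (y1 - y2)).
Proof.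
case=> _ /(_ (row_mx x1 y1) (row_mx x2 y2)).
rewrite opp_row_mx add_row_mx; apply: le_trans.
by rewrite !grad_yE -linearB norm2_rsubmx_le.
Qed.

End PartialGradient.

(** * Consequences of the error bound for the solution map *)

Section ErrorBound.
Context {R : realType} {m n : nat} (f : 'rV[R]_m -> 'rV[R]_n -> R) (Lf Hf tau : R).
Hypothesis f_smooth : L_smooth Lf (joint f).
Hypothesis f_twice : twice_differentiable (joint f).
Hypothesis f_hess : forall (x1 x2 : 'rV[R]_m) (y1 y2 : 'rV[R]_n),
  opnorm2 (grad_grad_y f x1 y1 - grad_grad_y f x2 y2)
    <= Hf * (norm2 (x1 - x2) + norm2 (y1 - y2)).
Hypothesis argmin_closed : forall x : 'rV[R]_m, argmin f x !=set0 /\ closed (argmin f x).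
Hypothesis tau_gt0 : 0 < tau.
Hypothesis error_bound : forall (x : 'rV[R]_m) (y : 'rV[R]_n),
  dist y (argmin f x) <= tau * norm2 (grad_y f x y).

Lemma argmin_near_grad x y :
  exists2 z, argmin f x z & norm2 (z - y) <= tau * norm2 (grad_y f x y).
Proof.
have [S0 Scl] := argmin_closed x.
have [z Sz zy] := dist_attained y _ S0 Scl; exists z => //.
by rewrite norm2B (le_trans zy).
Qed.

(** As [grad_y f x y = 0], moving [x] to [x'] makes the gradient at most [Lf * norm2 (x' - x)], and
    the error bound turns this into a distance. *)
Lemma argmin_lipschitz x x' y : argmin f x y ->
  exists2 z, argmin f x' z & norm2 (z - y) <= tau * Lf * norm2 (x' - x).
Proof.
move=> Sy; have [z Sz zy] := argmin_near_grad x' y; exists z => //.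
rewrite (le_trans zy)// -mulrA ler_pM2l//.
have := grad_y_lipschitz f Lf x' x y y f_smooth.
by rewrite subrr norm2_row_mxr0 (grad_y_argmin _ _ _ f_twice.1 Sy) subr0.
Qed.

(** The factor [norm2 d + norm2 v] occurs twice: it bounds the length of the direction [row_mx d v],
    and it comes from the Lipschitz condition on the second derivative. *)
Lemma grad_y_extrapolation x d y v s theta : 0 < s -> 0 <= theta -> 0 <= Hf ->
  argmin f x y -> argmin f (x + s *: d) (y + s *: v) ->
  norm2 (grad_y f (x - theta *: d) (y - theta *: v))
    <= Hf * (norm2 d + norm2 v) ^+ 2 / 2 * (theta * (s + theta)).
Proof.
move=> s0 th0 Hf0 Sy Sys.
pose g z := grad_y f (lsubmx z) (rsubmx z).
have gE t : g (row_mx x y + t *: row_mx d v) = grad_y f (x + t *: d) (y + t *: v).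
  by rewrite scale_row_mx add_row_mx /g row_mxKl row_mxKr.
rewrite -!scaleNr -gE scaleNr; apply: norm2_extrapolation => //.
- by rewrite mulr_ge0// sqr_ge0.
- by move=> t; apply: differentiable_grad_y; exact: f_twice.2.
- move=> t u; rewrite (le_trans (norm2_mulmx_le _ _))//.
  rewrite expr2 mulrA mulrAC ler_pM ?opnorm2_ge0 ?norm2_ge0 ?norm2_row_mx_le//.
  rewrite !scale_row_mx !add_row_mx (le_trans (f_hess _ _ _ _))//.
  rewrite -mulrA ler_wpM2l//.
  have diffE k (b e : 'rV[R]_k) : b + t *: e - (b + u *: e) = (t - u) *: e.
    by rewrite opprD addrACA subrr add0r scalerBl.
  by rewrite !diffE !norm2Z -mulrDr mulrC.
- by have := gE 0; rewrite !scale0r !addr0 => ->; exact: grad_y_argmin f_twice.1 Sy.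
- by rewrite gE; exact: grad_y_argmin f_twice.1 Sys.
Qed.

Lemma argmin_set_smooth_half L x1 x2 y (theta : R) :
  2 * Hf * tau * (1 + 9 * Lf ^+ 2 * tau ^+ 2) <= L ->
  4 * Lf ^+ 2 * tau ^+ 2 <= L ->
  x1 != x2 -> 0 <= theta -> theta <= 1 / 2 ->
  argmin f (theta *: x1 + (1 - theta) *: x2) y ->
  exists y1 y2, [/\ argmin f x1 y1, argmin f x2 y2,
    norm2 (theta *: y1 + (1 - theta) *: y2 - y)
      <= L / 2 * theta * (1 - theta) * norm2 (x1 - x2) ^+ 2
    & norm2 (y1 - y2) ^+ 2 <= L * norm2 (x1 - x2) ^+ 2].
Proof.
move=> L1 L2 x12 th0 th1; set x := _ + _ => Sy.
set d := x1 - x2; set N := norm2 d.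
have x1E : x1 = x + (1 - theta) *: d.
  by apply/rowP => i; rewrite !mxE; ring.
have x2E : x2 = x - theta *: d.
  by apply/rowP => i; rewrite !mxE; ring.
have N0 : 0 < N.
  rewrite lt_neqAle norm2_ge0 andbT eq_sym; apply: contra x12 => /eqP/norm2_eq0.
  by move=> /eqP; rewrite subr_eq0.
(* The signs of [Lf] and [Hf] follow from the Lipschitz inequalities at two points with
   [x1 != x2]. *)
have Lf0 : 0 <= Lf.
  have := le_trans (norm2_ge0 _) (grad_y_lipschitz f Lf x1 x2 0 0 f_smooth).
  by rewrite subrr norm2_row_mxr0 pmulr_lge0.
have Hf0 : 0 <= Hf.
  have := le_trans (opnorm2_ge0 _) (f_hess x1 x2 0 0).
  by rewrite subrr norm20 addr0 pmulr_lge0.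
set a := tau * Lf; have a0 : 0 <= a by rewrite mulr_ge0// ltW.
have s0 : 0 < 1 - theta by lra.
(* This is [tau] times the extrapolation bound with [s = 1 - theta] and
   [norm2 d + norm2 v <= (1 + a) * N]. *)
pose E := tau * Hf * (1 + a) ^+ 2 / 2 * theta * N ^+ 2.
have HtL : tau * Hf * (1 + a) ^+ 2 <= L.
  apply: le_trans L1.
  have -> : 2 * Hf * tau * (1 + 9 * Lf ^+ 2 * tau ^+ 2) =
    tau * Hf * (2 * (1 + 9 * a ^+ 2)) by rewrite /a; ring.
  (* What remains is [(1 + a) ^+ 2 <= 2 * (1 + 9 * a ^+ 2)]. *)
  by rewrite ler_wpM2l ?mulr_ge0 ?(ltW tau_gt0)//; nra.
have aL : (2 * a) ^+ 2 <= L.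
  by apply: le_trans L2; rewrite le_eqVlt; apply/orP; left; apply/eqP; rewrite /a; ring.
have [y1 S1 y1y] := argmin_lipschitz x x1 y Sy.
have {y1y} y1y : norm2 (y1 - y) <= (1 - theta) * (a * N).
  by move: y1y; rewrite x1E [x + _]addrC addrK norm2Z gtr0_norm// mulrCA.
(* The slope of the segment from [y] to [y1]; the extrapolated point over [x2] is
   [y - theta *: v]. *)
pose v := (1 - theta)^-1 *: (y1 - y).
have y1E : y1 = y + (1 - theta) *: v.
  by rewrite /v scalerA divff ?gt_eqF// scale1r addrC subrK.
have vN : norm2 v <= a * N.
  by rewrite /v norm2Z gtr0_norm ?invr_gt0// ler_pdivrMl.
have [Ea|aE] := leP E (a * N).
  have [y2 S2 y2y] := argmin_near_grad x2 (y - theta *: v).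
  have {}y2y : norm2 (y2 - (y - theta *: v)) <= E.
    apply: (le_trans y2y); rewrite x2E.
    have := grad_y_extrapolation x d y v (1 - theta) theta s0 th0 Hf0 Sy.
    rewrite -x1E -y1E => /(_ S1) gE.
    have -> : E = tau * (Hf * ((1 + a) * N) ^+ 2 / 2 * (theta * (1 - theta + theta))).
      by rewrite /E; field.
    rewrite ler_pM2l// (le_trans gE)// subrK mulr1 ler_wpM2r//.
    rewrite ler_wpM2r ?invr_ge0// ler_wpM2l// ler_sqr ?nnegrE.
    - by rewrite mulrDl mul1r lerD2l.
    - by rewrite addr_ge0 ?norm2_ge0.
    - by rewrite mulr_ge0 ?addr_ge0// ltW.
  exists y1, y2; split=> //.
  (* The extrapolated point would give error 0, so only its distance to [y2], at most [E], counts,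
     with weight [1 - theta]. *)
  - have -> : theta *: y1 + (1 - theta) *: y2 - y =
        (1 - theta) *: (y2 - (y - theta *: v)).
      by rewrite y1E; apply/rowP => i; rewrite !mxE; ring.
    rewrite norm2Z gtr0_norm// -[_ * (1 - theta) * _]mulrA mulrCA ler_pM2l//.
    rewrite (le_trans y2y)// /E ler_wpM2r ?sqr_ge0// ler_wpM2r// ler_wpM2r//.
  - have y12 : norm2 (y1 - y2) <= 2 * a * N.
      have -> : y1 - y2 = v - (y2 - (y - theta *: v)).
        by rewrite y1E; apply/rowP => i; rewrite !mxE; ring.
      by rewrite (le_trans (ler_norm2D _ _))// norm2N; lra.
    rewrite (@le_trans _ _ ((2 * a * N) ^+ 2))//.
      by rewrite ler_sqr ?nnegrE ?norm2_ge0// !mulr_ge0// ltW.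
    by rewrite exprMn ler_wpM2r ?sqr_ge0.
have [y2 S2 y2y] := argmin_lipschitz x x2 y Sy.
have {y2y} y2y : norm2 (y2 - y) <= theta * (a * N).
  move: y2y; rewrite x2E [x - _]addrC addrK norm2N norm2Z ger0_norm//.
  by rewrite mulrCA.
exists y1, y2; split=> //.
- have -> : theta *: y1 + (1 - theta) *: y2 - y =
      theta *: (y1 - y) + (1 - theta) *: (y2 - y).
    by apply/rowP => i; rewrite !mxE; ring.
  rewrite (le_trans (ler_norm2D _ _))// !norm2Z ger0_norm// (gtr0_norm s0).
  (* Each of the two terms is at most [theta * (1 - theta) * (a * N)], and here [a * N < E]. *)
  apply: (@le_trans _ _ (theta * (1 - theta) * (2 * E))).
    have h1 := ler_wpM2l th0 y1y; have h2 := ler_wpM2l (ltW s0) y2y.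
    have h3 : theta * (1 - theta) * (a * N) <= theta * (1 - theta) * E.
      by rewrite ler_wpM2l ?mulr_ge0 ?(ltW s0) ?(ltW aE).
    lra.
  have -> : L / 2 * theta * (1 - theta) * N ^+ 2 =
    theta * (1 - theta) * (L * (1 / 2) * N ^+ 2) by field.
  rewrite ler_wpM2l ?mulr_ge0 ?(ltW s0)//.
  have -> : 2 * E = tau * Hf * (1 + a) ^+ 2 * theta * N ^+ 2 by rewrite /E; field.
  (* Here [theta <= 1 / 2] absorbs the factor 2 in front of [E]. *)
  rewrite ler_wpM2r ?sqr_ge0// ler_pM//.
  by rewrite mulr_ge0 ?sqr_ge0// mulr_ge0// ltW.
(* Passing through [y], the weights [1 - theta] and [theta] add up to 1. *)
- have y12 : norm2 (y1 - y2) <= 1 * (a * N).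
    rewrite -(subrKA y) (le_trans (ler_norm2D _ _))// [norm2 (y - y2)]norm2B.
    by lra.
  rewrite (@le_trans _ _ ((2 * a * N) ^+ 2))//.
    rewrite ler_sqr ?nnegrE ?norm2_ge0//; last by rewrite !mulr_ge0// ltW.
    by have : 0 <= a * N; [rewrite mulr_ge0// ltW|lra].
  by rewrite exprMn ler_wpM2r ?sqr_ge0.
Qed.

End ErrorBound.

(** * Set smoothness of the solution map *)

Theorem theorem2 (R : realType) (m n : nat) (f : 'rV[R]_m -> 'rV[R]_n -> R)
    (Lf Hf tau : R)
    (A1_smooth : L_smooth Lf (joint f))
    (A1_twice : twice_differentiable (joint f))
    (A1_hess : forall (x1 x2 : 'rV[R]_m) (y1 y2 : 'rV[R]_n),
       opnorm2 (grad_grad_y f x1 y1 - grad_grad_y f x2 y2)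
         <= Hf * (norm2 (x1 - x2) + norm2 (y1 - y2)))
    (A2 : forall x : 'rV[R]_m,
       [/\ argmin f x !=set0, closed (argmin f x) & convex (argmin f x)])
    (tau_gt0 : 0 < tau)
    (A3 : forall (x : 'rV[R]_m) (y : 'rV[R]_n),
       dist y (argmin f x) <= tau * norm2 (grad_y f x y)) :
  set_smooth
    (Num.max (2 * Hf * tau * (1 + 9 * Lf ^+ 2 * tau ^+ 2))
             (4 * Lf ^+ 2 * tau ^+ 2))
    (argmin f).
Proof.
split=> [x y lambda _ _|x1 x2 _ _ theta /andP[th0 th1] y Sy].
  by rewrite inE /dom /=; have [] := A2 (conv lambda x y).
set L := Num.max _ _.
have L1 : 2 * Hf * tau * (1 + 9 * Lf ^+ 2 * tau ^+ 2) <= L by rewrite le_max lexx.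
have L2 : 4 * Lf ^+ 2 * tau ^+ 2 <= L by rewrite le_max lexx orbT.
have Scl x : argmin f x !=set0 /\ closed (argmin f x) by have [] := A2 x.
have half := argmin_set_smooth_half f Lf Hf tau A1_smooth A1_twice A1_hess Scl tau_gt0 A3 L.
(* For equal base points, [y] itself serves as both [y1] and [y2]. *)
have [x12|x12] := eqVneq x1 x2.
  move: Sy; rewrite x12 -scalerDl addrC subrK scale1r => Sy.
  exists y, y; rewrite -scalerDl [theta + _]addrC subrK scale1r !subrr !norm20.
  by rewrite expr0n/= !mulr0.
have [th|/ltW th] := leP theta (1 / 2); first exact: half.
(* For [theta > 1 / 2], exchanging [x1] and [x2] replaces [theta] by [1 - theta]. *)
have Sy' : argmin f ((1 - theta) *: x2 + (1 - (1 - theta)) *: x1) y.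
  by rewrite subKr addrC.
have x21 : x2 != x1 by rewrite eq_sym.
have th0' : 0 <= 1 - theta by rewrite subr_ge0.
have th' : 1 - theta <= 1 / 2 by lra.
have [y2 [y1 [S2 S1 h1 h2]]] := half x2 x1 y (1 - theta) L1 L2 x21 th0' th' Sy'.
exists y1, y2; split=> //.
- by move: h1; rewrite subKr [_ *: y2 + _]addrC [L / 2 * _ * theta]mulrAC [norm2 (x2 - _)]norm2B.
- by rewrite norm2B [norm2 (x1 - _)]norm2B.
Qed.
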